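(* If $A$ is a finite dimensional cocommutative Hopf algebra over a field $k$, then its Heisenberg double $\mathcal{H}(A)=A\#A^*$ is (carries the structure of) a vertex group over $A$.
   Context: $\Delta(a)=\sum a_1\otimes a_2$ on $A$; on $A^*$ the product is convolution and the coproduct is given by $p(ab)=\sum p_1(a)p_2(b)$. The Heisenberg double $\mathcal{H}(A)$ is the algebra $A\otimes A^*$ with product $(a\#p)(a'\#p')=\sum a(p_1\rightharpoonup a')\#p_2p'$, where $p\rightharpoonup a=\sum p(a_2)a_1$. Vertex group: let $H$ be a cocommutative Hopf algebra. A vertex group over $H$ is an $H$-bimodule algebra $K$, i.e. an algebra (not necessarily commutative) which is an $H$-bimodule with $h\cdot(kk')=\sum(h_1\cdot k)(h_2\cdot k')$, $(kk')\cdot h=\sum(k\cdot h_1)(k'\cdot h_2)$, $h\cdot 1=\varepsilon(h)1=1\cdot h$, together with a map $\alpha:H^*\to K$ which is a morphism of $H$-bimodule algebras (where $H^*$ has the convolution product and the regular actions $(h\rightharpoonup p)(h')=p(h'h)$, $(p\leftharpoonup h)(h')=p(hh')$) and an algebra anti-isomorphism $\tau:K\to K$ such that $\tau(\alpha(p))=\alpha(S(p))$, $\tau(h\cdot k)=\tau(k)\cdot S(h)$, $\tau(k\cdot h)=S(h)\cdot\tau(k)$ for all $h\in H$, $p\in H^*$, $k\in K$, where $S$ denotes both the antipode of $H$ and that of $H^*$ ($S(p)=p\circ S$). *)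

(* Defs.v *)
From HB Require Import structures.
From mathcomp Require Import all_boot all_order all_algebra all_field.

Set Implicit Arguments.
Unset Strict Implicit.
Unset Printing Implicit Defensive.

Import GRing.Theory VectorInternalTheory.
Local Open Scope ring_scope.

(* The tensor product of two finite dimensional spaces, as the space of       *)
(* coordinates on the products of the basis vectors [r2v 'e_i]. Lemmas        *)
(* [tensorK], [tliftE] and [tliftC] give its universal property, so that      *)
(* [tlift (fun x y => B x y) (comul a)] is the Sweedler sum of the B a_1 a_2. *)
Definition tensor (k : fieldType) (U V : vectType k) :=
  'M[k]_(dim U, dim V).

HB.instance Definition _ (k : fieldType) (U V : vectType k) :=
  Vector.on (tensor U V).

Section Tensor.
Variables (k : fieldType) (U V : vectType k).

Definition tens (u : U) (v : V) : tensor U V := (v2r u)^T *m v2r v.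

(* The linear map induced by B; meaningful only when B is bilinear. *)
Definition tlift (W : lmodType k) (B : U -> V -> W) (t : tensor U V) : W :=
  \sum_i \sum_j (t : 'M_(_, _)) i j *: B (r2v 'e_i) (r2v 'e_j).

Fact tens_is_bilinear : bilinear_for *:%R *:%R tens.
Proof.
split=> [v a x y|u a x y]; rewrite /tens.
  by rewrite linearP /= linearP /= mulmxDl scalemxAl.
by rewrite linearP /= mulmxDr scalemxAr.
Qed.

Fact tlift_is_linear (W : lmodType k) (B : U -> V -> W) : linear (tlift B).
Proof.
move=> a s t; rewrite /tlift scaler_sumr -big_split; apply: eq_bigr => i _ /=.
rewrite scaler_sumr -big_split; apply: eq_bigr => j _ /=.
by rewrite !mxE scalerDl scalerA.
Qed.

HB.instance Definition _ (W : lmodType k) (B : U -> V -> W) :=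
  GRing.isLinear.Build k (tensor U V) W *:%R (tlift B) (tlift_is_linear B).

Lemma r2v_sum (T : vectType k) (u : T) : u = \sum_i v2r u 0 i *: r2v 'e_i.
Proof.
rewrite -{1}[u]v2rK {1}[v2r u]row_sum_delta linear_sum.
by apply: eq_bigr => i _; rewrite linearZ.
Qed.

Lemma linear_r2v_sum (T : vectType k) (W : lmodType k) (f : T -> W) u :
  linear f -> f u = \sum_i v2r u 0 i *: f (r2v 'e_i).
Proof.
move=> f_lin; pose F : {linear T -> W} :=
  HB.pack f (GRing.isLinear.Build k T W *:%R f f_lin).
rewrite -[f u]/(F u) {1}[u]r2v_sum linear_sum.
by apply: eq_bigr => i _; rewrite linearZ.
Qed.

Lemma tliftE (W : lmodType k) (B : U -> V -> W) u v :
  bilinear_for *:%R *:%R B -> tlift B (tens u v) = B u v.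
Proof.
case=> Bl Br; rewrite (linear_r2v_sum u (Bl v)); apply: eq_bigr => i _.
rewrite /= (linear_r2v_sum v (Br (r2v 'e_i))) scaler_sumr.
apply: eq_bigr => j _; rewrite scalerA; congr (_ *: _).
by rewrite /tens mxE big_ord1 mxE.
Qed.

Lemma tensorK (t : tensor U V) : tlift tens t = t.
Proof.
rewrite /tlift [RHS]matrix_sum_delta; apply: eq_bigr => i _; apply: eq_bigr => j _.
by rewrite /tens !r2vK trmx_delta mul_delta_mx.
Qed.

Lemma eq_tlift (W : lmodType k) (B C : U -> V -> W) t :
  (forall u v, B u v = C u v) -> tlift B t = tlift C t.
Proof. by move=> eqB; do 2!(apply: eq_bigr => ? _); rewrite eqB. Qed.

Lemma tliftC (W W' : lmodType k) (f : {linear W -> W'}) (B : U -> V -> W) t :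
  f (tlift B t) = tlift (fun u v => f (B u v)) t.
Proof.
by rewrite /tlift linear_sum; apply: eq_bigr => i _; rewrite linear_sum;
   apply: eq_bigr => j _; rewrite linearZ.
Qed.

End Tensor.

Section TensorMaps.
Variable k : fieldType.

Definition tmap (U V U' V' : vectType k) (f : U -> U') (g : V -> V') :
  tensor U V -> tensor U' V' := tlift (fun u v => tens (f u) (g v)).

Definition tassoc (U V W : vectType k) :
  tensor (tensor U V) W -> tensor U (tensor V W) :=
  tlift (fun s w => tlift (fun u v => tens u (tens v w)) s).

Definition tflip (U V : vectType k) : tensor U V -> tensor V U :=
  tlift (fun u v => tens v u).

Definition tmul (A : falgType k) (s t : tensor A A) : tensor A A :=
  tlift (fun a b => tlift (fun c d => tens (a * c) (b * d)) t) s.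

End TensorMaps.

HB.mixin Record Falgebra_isHopf (k : fieldType) A of Falgebra k A := {
  comul : 'Hom(A, tensor A A);
  counit : 'Hom(A, k^o);
  antipode : 'End(A);
  comulA : forall a : A,
    tassoc (tmap comul id (comul a)) = tmap id comul (comul a);
  counitl : forall a : A, tlift (fun x y => (counit x : k) *: y) (comul a) = a;
  counitr : forall a : A, tlift (fun x y => (counit y : k) *: x) (comul a) = a;
  comul1 : comul 1 = tens 1 1;
  comulM : forall a b : A, comul (a * b) = tmul (comul a) (comul b);
  counit1 : counit 1 = 1;
  counitM : forall a b : A, counit (a * b) = counit a * counit b;
  antipodel : forall a : A,
    tlift (fun x y => antipode x * y) (comul a) = (counit a : k)%:A;
  antipoder : forall a : A,
    tlift (fun x y => x * antipode y) (comul a) = (counit a : k)%:A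
}.

#[short(type="hopfAlgType")]
HB.structure Definition HopfAlgebra (k : fieldType) :=
  {A of Falgebra k A & Falgebra_isHopf k A}.

HB.mixin Record HopfAlgebra_isCocommutative (k : fieldType) A
    of HopfAlgebra k A := {
  comulC : forall a : A, tflip (comul a) = comul a
}.

#[short(type="cocommHopfAlgType")]
HB.structure Definition CocommHopfAlgebra (k : fieldType) :=
  {A of HopfAlgebra k A & HopfAlgebra_isCocommutative k A}.

Section LiftTheory.
Variable k : fieldType.

Lemma tlift_linear (U V : vectType k) (Z W : lmodType k) (B : Z -> U -> V -> W)
    (t : tensor U V) :
  (forall u v, linear (fun z => B z u v)) -> linear (fun z => tlift (B z) t).
Proof.
move=> B_lin a y z; rewrite /tlift scaler_sumr -big_split.
apply: eq_bigr => i _ /=; rewrite scaler_sumr -big_split; apply: eq_bigr => j _.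
by rewrite B_lin /= scalerDr !scalerA mulrC.
Qed.

Lemma exchange_tlift (U V U' V' : vectType k) (W : lmodType k)
    (B : U -> V -> U' -> V' -> W) (s : tensor U V) (t : tensor U' V') :
  tlift (fun u v => tlift (B u v) t) s =
  tlift (fun u' v' => tlift (fun u v => B u v u' v') s) t.
Proof.
rewrite /tlift; under eq_bigr do under eq_bigr do rewrite scaler_sumr.
under eq_bigr do under eq_bigr do under eq_bigr do rewrite scaler_sumr.
under [RHS]eq_bigr do under eq_bigr do rewrite scaler_sumr.
under [RHS]eq_bigr do under eq_bigr do under eq_bigr do rewrite scaler_sumr.
under eq_bigr do rewrite exchange_big.
rewrite exchange_big; apply: eq_bigr => i _.
under eq_bigr do rewrite exchange_big.
rewrite exchange_big; apply: eq_bigr => j _.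
apply: eq_bigr => i' _; apply: eq_bigr => j' _.
by rewrite !scalerA mulrC.
Qed.

Lemma tassocE (U V W : vectType k) (s : tensor U V) (w : W) :
  tassoc (tens s w) = tlift (fun u v => tens u (tens v w)) s.
Proof.
rewrite /tassoc tliftE //; split=> [w' a x y|s']; first by rewrite linearP.
apply: tlift_linear => u v a x y.
by rewrite (tens_is_bilinear _ _).2 (tens_is_bilinear _ _).2.
Qed.

Lemma tassocC (U V W U' V' : vectType k)
    (B : U' -> V' -> tensor (tensor U V) W) (t : tensor U' V') :
  tassoc (tlift B t) = tlift (fun u v => tassoc (B u v)) t.
Proof. exact: tliftC. Qed.

End LiftTheory.

Section LiftAlgebra.
Variables (k : fieldType) (U V : vectType k) (t : tensor U V).

Lemma tliftZr (W : lmodType k) (c : k) (B : U -> V -> W) :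
  c *: tlift B t = tlift (fun u v => c *: B u v) t.
Proof.
rewrite /tlift scaler_sumr; apply: eq_bigr => i _; rewrite scaler_sumr.
by apply: eq_bigr => j _; rewrite !scalerA mulrC.
Qed.

Lemma tliftZl (W : lmodType k) (w : W) (B : U -> V -> k^o) :
  (tlift B t : k) *: w = tlift (fun u v => (B u v : k) *: w) t.
Proof.
rewrite /tlift scaler_suml; apply: eq_bigr => i _; rewrite scaler_suml.
by apply: eq_bigr => j _; rewrite scalerA.
Qed.

Lemma tliftMr (W : algType k) (w : W) (B : U -> V -> W) :
  w * tlift B t = tlift (fun u v => w * B u v) t.
Proof.
rewrite /tlift mulr_sumr; apply: eq_bigr => i _; rewrite mulr_sumr.
by apply: eq_bigr => j _; rewrite scalerAr.
Qed.

Lemma tliftMl (W : algType k) (w : W) (B : U -> V -> W) :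
  tlift B t * w = tlift (fun u v => B u v * w) t.
Proof.
rewrite /tlift mulr_suml; apply: eq_bigr => i _; rewrite mulr_suml.
by apply: eq_bigr => j _; rewrite scalerAl.
Qed.

End LiftAlgebra.

Section SweedlerTheory.
Variables (k : fieldType) (A : hopfAlgType k) (W : lmodType k).

Definition trilinear (T : A -> A -> A -> W) :=
  [/\ forall y z, linear (fun x => T x y z),
      forall x z, linear (fun y => T x y z) & forall x y, linear (T x y)].

Lemma sweedlerA (T : A -> A -> A -> W) a : trilinear T ->
  tlift (fun x y => tlift (T x) (comul y)) (comul a) =
  tlift (fun x z => tlift (fun x y => T x y z) (comul x)) (comul a).
Proof.
case=> T1 T2 T3; pose L : {linear tensor A (tensor A A) -> W} :=
  tlift (fun x s => tlift (T x) s).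
have LE x s : L (tens x s) = tlift (T x) s.
  rewrite /L /= tliftE //; split=> [s'|x' b y z]; first exact: tlift_linear.
  by rewrite linearP.
have TE x y z : tlift (T x) (tens y z) = T x y z.
  by apply: tliftE; split=> [z'|y']; [exact: T2|exact: T3].
have := congr1 L (comulA a); rewrite /tmap tassocC !tliftC => eqL.
rewrite -[LHS](eq_tlift _ (fun x y => LE x (comul y))) -eqL.
apply: eq_tlift => x z; rewrite tassocE tliftC.
by apply: eq_tlift => u v; rewrite LE TE.
Qed.

Lemma sweedlerM (B : A -> A -> W) a b : bilinear_for *:%R *:%R B ->
  tlift B (comul (a * b)) =
  tlift (fun x y => tlift (fun z t => B (x * z) (y * t)) (comul b)) (comul a).
Proof.
move=> Bbl; rewrite comulM /tmul (tliftC (tlift B)); apply: eq_tlift => x y.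
by rewrite (tliftC (tlift B)); apply: eq_tlift => z t; rewrite /= tliftE.
Qed.

Lemma sweedler1 (B : A -> A -> W) : bilinear_for *:%R *:%R B ->
  tlift B (comul 1) = B 1 1.
Proof. by move=> Bbl; rewrite comul1 tliftE. Qed.

Lemma sweedler_counitl (f : {linear A -> W}) a :
  tlift (fun x y => counit x *: f y) (comul a) = f a.
Proof.
rewrite -{2}[a]counitl tliftC; apply: eq_tlift => x y; by rewrite linearZ.
Qed.

Lemma sweedler_counitr (f : {linear A -> W}) a :
  tlift (fun x y => counit y *: f x) (comul a) = f a.
Proof.
rewrite -{2}[a]counitr tliftC; apply: eq_tlift => x y; by rewrite linearZ.
Qed.

End SweedlerTheory.

Lemma linfunE (k : fieldType) (U V : vectType k) (f : U -> V) :
  linear f -> linfun f =1 f.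
Proof.
move=> f_lin u; pose F : {linear U -> V} :=
  HB.pack f (GRing.isLinear.Build k U V *:%R f f_lin).
exact: (lfunE F).
Qed.

Lemma r2v_sum0 (k : fieldType) (U : vectType k) (c : 'I_(dim U) -> k) :
  \sum_i c i *: (r2v (delta_mx 0 i) : U) = 0 -> forall i, c i = 0.
Proof.
move=> c0 i; have := congr1 v2r c0; rewrite linear_sum linear0 => /rowP/(_ i).
rewrite summxE (bigD1 i) //= big1 => [|j neq_ji].
  by rewrite linearZ /= r2vK !mxE !eqxx addr0 mulr1.
by rewrite linearZ /= r2vK !mxE eqxx eq_sym (negPf neq_ji) mulr0.
Qed.

Definition dual (k : fieldType) (A : vectType k) := 'Hom(A, k^o).

HB.instance Definition _ (k : fieldType) (A : vectType k) :=
  Vector.on (dual A).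

Section DualAlgebra.
Variables (k : fieldType) (A : hopfAlgType k).
Implicit Types p q r : dual A.

(* Convolution *)
Definition dual_mul p q : dual A :=
  linfun (fun a => tlift (fun x y => p x * q y : k^o) (comul a)).

Definition dual_one : dual A := counit.

Lemma dualP p q : p = q <-> forall a, p a = q a.
Proof. by split=> [-> //|eqpq]; apply/lfunP. Qed.

Lemma dual_linear p (c : k) x y : p (c *: x + y) = c * p x + p y :> k.
Proof. by rewrite linearP. Qed.

Lemma scale_regular (c : k) (x : k^o) : c *: x = c * x.
Proof. by []. Qed.

Lemma dual_linE a p q x : (a *: p + q) x = a * p x + q x.
Proof. by rewrite add_lfunE scale_lfunE. Qed.

Lemma dual_mulE p q a :
  dual_mul p q a = tlift (fun x y => p x * q y : k^o) (comul a).
Proof. by rewrite linfunE // => b x y; rewrite !linearP. Qed.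

Fact dual_mulA : associative dual_mul.
Proof.
move=> p q r; apply/dualP => a; rewrite !dual_mulE.
under eq_tlift do rewrite dual_mulE.
under [RHS]eq_tlift do rewrite dual_mulE.
pose T x y z : k^o := p x * q y * r z.
have Ttri : trilinear T.
  split=> [y z b x x'|x z b y y'|x y b z z'];
    by rewrite /T dual_linear scale_regular ?mulrDl ?mulrDr ?mulrDl ?mulrA;
       congr (_ + _); rewrite ?[p x * b]mulrC ?[p x * q y * b]mulrC ?mulrA.
transitivity (tlift (fun x y => tlift (T x) (comul y)) (comul a)).
  apply: eq_tlift => x y; rewrite /tlift mulr_sumr; apply: eq_bigr => i _.
  rewrite mulr_sumr; apply: eq_bigr => j _.
  by rewrite -scalerAr mulrA.
rewrite sweedlerA //; apply: eq_tlift => x y.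
rewrite /tlift mulr_suml; apply: eq_bigr => i _.
by rewrite mulr_suml; apply: eq_bigr => j _; rewrite -scalerAl.
Qed.

Fact dual_mul1l : left_id dual_one dual_mul.
Proof.
by move=> p; apply/dualP => a; rewrite dual_mulE -[RHS]sweedler_counitl.
Qed.

Fact dual_mul1r : right_id dual_one dual_mul.
Proof.
move=> p; apply/dualP => a; rewrite dual_mulE -[RHS]sweedler_counitr.
by apply: eq_tlift => x y; rewrite mulrC.
Qed.

Fact dual_mulDl : left_distributive dual_mul +%R.
Proof.
move=> p q r; apply/dualP => a; rewrite add_lfunE !dual_mulE.
rewrite /tlift -big_split; apply: eq_bigr => i _ /=.
rewrite -big_split; apply: eq_bigr => j _ /=.
by rewrite add_lfunE mulrDl scalerDr.
Qed.

Fact dual_mulDr : right_distributive dual_mul +%R.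
Proof.
move=> p q r; apply/dualP => a; rewrite add_lfunE !dual_mulE.
rewrite /tlift -big_split; apply: eq_bigr => i _ /=.
rewrite -big_split; apply: eq_bigr => j _ /=.
by rewrite add_lfunE mulrDr scalerDr.
Qed.

Fact dual_one_neq0 : dual_one != 0.
Proof.
apply/eqP => /dualP/(_ 1); rewrite /dual_one counit1 zero_lfunE => /eqP.
by rewrite oner_eq0.
Qed.

HB.instance Definition _ := GRing.Zmodule_isNzRing.Build (dual A)
  dual_mulA dual_mul1l dual_mul1r dual_mulDl dual_mulDr dual_one_neq0.

Lemma dualM p q a :
  (p * q) a = tlift (fun x y => p x * q y : k^o) (comul a).
Proof. exact: dual_mulE. Qed.

Fact dual_scaleAl (b : k) p q : b *: (p * q) = (b *: p) * q.
Proof.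
apply/dualP => a; rewrite scale_lfunE !dualM /tlift scaler_sumr.
apply: eq_bigr => i _; rewrite scaler_sumr; apply: eq_bigr => j _.
by rewrite scale_lfunE -scalerAl !scalerA (mulrC b).
Qed.

HB.instance Definition _ :=
  GRing.Lmodule_isLalgebra.Build k (dual A) dual_scaleAl.

Fact dual_scaleAr (b : k) p q : b *: (p * q) = p * (b *: q).
Proof.
apply/dualP => a; rewrite scale_lfunE !dualM /tlift scaler_sumr.
apply: eq_bigr => i _; rewrite scaler_sumr; apply: eq_bigr => j _.
by rewrite scale_lfunE -scalerAr !scalerA (mulrC b).
Qed.

HB.instance Definition _ :=
  GRing.Lalgebra_isAlgebra.Build k (dual A) dual_scaleAr.

Definition dual_coord i : dual A := linfun (fun a => v2r a 0 i : k^o).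

Lemma dual_coordE i a : dual_coord i a = v2r a 0 i.
Proof. by rewrite linfunE // => b x y; rewrite linearP /= !mxE. Qed.

(* The element of A^* (x) A^* dual to (a, b) |-> p (a * b); see               *)
(* [dual_comulE] and [dual_comul_uniq].                                       *)
Definition dual_comul p : tensor (dual A) (dual A) :=
  \sum_i \sum_j
    p (r2v (delta_mx 0 i) * r2v (delta_mx 0 j))
      *: tens (dual_coord i) (dual_coord j).

Lemma dual_comulE p a b :
  tlift (fun p1 p2 : dual A => p1 a * p2 b : k^o) (dual_comul p) = p (a * b).
Proof.
have pl x : linear (fun y => p (y * x)).
  by move=> c y z; rewrite mulrDl -scalerAl linearP.
have pr x : linear (fun y => p (x * y)).
  by move=> c y z; rewrite mulrDr -scalerAr linearP.
rewrite (linear_r2v_sum a (pl b)) linear_sum; apply: eq_bigr => i _ /=.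
rewrite (linear_r2v_sum b (pr _)) linear_sum scaler_sumr.
apply: eq_bigr => j _ /=; rewrite linearZ /= tliftE; last first.
  by split=> [q|q] c x y; rewrite add_lfunE scale_lfunE ?(mulrDl, mulrDr)
     -?scalerAl -?scalerAr.
rewrite !dual_coordE scalerA !scale_regular; exact: mulrC.
Qed.

Lemma dual_comul_uniq p (t : tensor (dual A) (dual A)) :
  (forall a b, tlift (fun p1 p2 : dual A => p1 a * p2 b : k^o) t = p (a * b)) ->
  t = dual_comul p.
Proof.
move=> tE; apply/eqP; rewrite -subr_eq0; apply/eqP.
have {tE}: forall a b,
    tlift (fun q r : dual A => q a * r b : k^o) (t - dual_comul p) = 0.
  by move=> a b; rewrite linearB /= tE dual_comulE subrr.
move: (_ - _) => {p}t t0; apply/matrixP => i j; rewrite mxE.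
pose w i' : dual A := \sum_j' t i' j' *: r2v (delta_mx 0 j').
suff w0: w i = 0 by rewrite (r2v_sum0 w0).
apply/dualP => b; rewrite zero_lfunE.
apply: (@r2v_sum0 _ (dual A) (fun i' => w i' b)).
apply/dualP => a; rewrite zero_lfunE -[RHS](t0 a b) sum_lfunE.
apply: eq_bigr => i' _; rewrite scale_lfunE sum_lfunE scaler_suml.
apply: eq_bigr => j' _; rewrite scale_lfunE !scale_regular -mulrA.
by congr (_ * _); apply: mulrC.
Qed.

End DualAlgebra.

Section Star.
Variables (k : fieldType) (A : hopfAlgType k).

Definition star (f g : A -> A) (b : A) : A :=
  tlift (fun b1 b2 : A =>
    tlift (fun g1 g2 : A => f (g2 * b1) * g1) (comul (g b2))) (comul b).

Lemma eq_star (f f' g g' : A -> A) :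
  f =1 f' -> g =1 g' -> star f g =1 star f' g'.
Proof.
move=> eqf eqg b; apply: eq_tlift => b1 b2; rewrite eqg.
by apply: eq_tlift => g1 g2; rewrite eqf.
Qed.

Lemma linear_comp (U V W : lmodType k) (f : {linear V -> W}) (g : U -> V) :
  linear g -> linear (fun u => f (g u)).
Proof. by move=> g_lin c u v; rewrite g_lin linearP. Qed.

Lemma linear_mull (U : lmodType k) (g : U -> A) (a : A) :
  linear g -> linear (fun u => g u * a).
Proof. by move=> g_lin c u v; rewrite g_lin mulrDl -scalerAl. Qed.

Lemma linear_mulr (U : lmodType k) (g : U -> A) (a : A) :
  linear g -> linear (fun u => a * g u).
Proof. by move=> g_lin c u v; rewrite g_lin mulrDr -scalerAr. Qed.

Lemma linear_sweedler (W U : lmodType k) (B : A -> A -> W) (g : U -> A) :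
  linear g -> linear (fun u => tlift B (comul (g u))).
Proof. by move=> g_lin c u v; rewrite g_lin !linearP. Qed.

Lemma starA (f g h : {linear A -> A}) :
  star (star f g) h =1 star f (star g h).
Proof.
move=> b; pose Q v1 v2 (x y z : A) : A :=
  tlift (fun g1 g2 : A => f (g2 * (y * v1)) * (g1 * x)) (comul (g (z * v2))).
have Q3 v1 v2 : trilinear (Q v1 v2).
  split=> [y z|x z|x y].
  - by apply: tlift_linear => g1 g2; do 2!apply: linear_mulr.
  - apply: tlift_linear => g1 g2; apply: linear_mull; apply: linear_comp.
    by apply: linear_mulr; apply: linear_mull.
  - by apply: linear_sweedler; apply: linear_comp; apply: linear_mull.
pose T v1 v2 b2 :=
  tlift (fun h1 y => tlift (Q v1 v2 h1) (comul y)) (comul (h b2)).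
have T3 : trilinear T.
  split=> [v2 b2|v1 b2|v1 v2].
  - apply: tlift_linear => x y; apply: tlift_linear => y1 y2.
    apply: tlift_linear => g1 g2; apply: linear_mull; apply: linear_comp.
    by do 2!apply: linear_mulr.
  - apply: tlift_linear => x y; apply: tlift_linear => y1 y2.
    by apply: linear_sweedler; apply: linear_comp; apply: linear_mulr.
  - by apply: linear_sweedler; apply: linear_comp.
transitivity (tlift (fun x z => tlift (fun x y => T x y z) (comul x)) (comul b)).
  apply: eq_tlift => b1 b2; rewrite [RHS]exchange_tlift.
  apply: eq_tlift => h1 h2; rewrite /star sweedlerM; last first.
    split=> [y2|y1]; first apply: tlift_linear => g1 g2.
      by apply: linear_mull; apply: linear_comp; apply: linear_mulr.
    by apply: linear_sweedler; apply: linear_comp.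
  rewrite tliftMl [RHS]exchange_tlift; apply: eq_tlift => u1 u2.
  rewrite tliftMl; apply: eq_tlift => v1 v2; rewrite tliftMl.
  by apply: eq_tlift => g1 g2; rewrite mulrA.
rewrite -sweedlerA //; apply: eq_tlift => b1 y; rewrite [in RHS]/star.
rewrite (tliftC comul) (tliftC (tlift _)) /=; apply: eq_tlift => c1 c2.
rewrite /T sweedlerA // (tliftC comul) (tliftC (tlift _)) /=.
apply: eq_tlift => h1 h2; rewrite /Q /=.
rewrite sweedlerM; last first.
  split=> [y2|y1]; first by apply: linear_mulr.
  by apply: linear_mull; apply: linear_comp; apply: linear_mull.
rewrite exchange_tlift; apply: eq_tlift => g1 g2; apply: eq_tlift => k1 k2.
by rewrite !mulrA.
Qed.

Definition counit_one (b : A) : A := (counit b : k)%:A.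

Lemma star1l (f : {linear A -> A}) : star counit_one f =1 f.
Proof.
move=> b; rewrite -[RHS]sweedler_counitl; apply: eq_tlift => b1 b2.
rewrite -[in RHS](counitr (f b2)) tliftZr; apply: eq_tlift => g1 g2.
by rewrite /counit_one -scalerAl mul1r counitM scalerA mulrC.
Qed.

Lemma star1r (f : {linear A -> A}) : star f counit_one =1 f.
Proof.
move=> b; rewrite -[RHS]sweedler_counitr; apply: eq_tlift => b1 b2.
rewrite /counit_one !linearZ /= sweedler1 ?mul1r ?mulr1 //.
split=> [y|x]; first by apply: linear_mulr.
by apply: linear_mull; apply: linear_comp; apply: linear_mull.
Qed.

End Star.

Section Heisenberg.
Variables (k : fieldType) (A : hopfAlgType k).
Implicit Types (p q : dual A) (a b : A).

Definition dual_act p a : A := tlift (fun x y => (p y : k) *: x) (comul a).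

Definition heisenberg : Type := tensor A (dual A).

HB.instance Definition _ := Vector.on heisenberg.

Implicit Types x y z : heisenberg.

Definition heis_one : heisenberg := tens (1 : A) (1 : dual A).

Definition heis_mul x y : heisenberg :=
  tlift (fun a p => tlift (fun a' p' =>
    tlift (fun p1 p2 : dual A => tens (a * dual_act p1 a') (p2 * p'))
      (dual_comul p)) y) x.

Lemma heis_mulE a p a' p' :
  heis_mul (tens a p) (tens a' p') =
  tlift (fun p1 p2 : dual A => tens (a * dual_act p1 a') (p2 * p'))
    (dual_comul p).
Proof.
have tensl := (tens_is_bilinear A (dual A)).1.
have tensr := (tens_is_bilinear A (dual A)).2.
have actl q : linear (dual_act q).
  by move=> c u v; rewrite /dual_act !linearP.
have comull : linear (@dual_comul k A).
  move=> c q r; rewrite /dual_comul scaler_sumr -big_split.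
  apply: eq_bigr => i _ /=; rewrite scaler_sumr -big_split.
  by apply: eq_bigr => j _ /=; rewrite dual_linE scalerDl scalerA.
rewrite /heis_mul tliftE.
  rewrite tliftE //; split=> [q|u]; apply: tlift_linear => p1 p2 d x y /=.
    by rewrite actl mulrDr -scalerAr tensl.
  by rewrite mulrDr -scalerAr tensr.
split=> [q|u]; apply: tlift_linear => a1 q1.
  by apply: tlift_linear => p1 p2 d x y; rewrite mulrDl -scalerAl tensl.
by move=> d x y; rewrite comull linearP.
Qed.

(* The linear bijection A # A^* -> End(A) given by a # p |-> (b |-> p b *: a) *)
(* turns the product of A # A^* into [star].                                  *)
Definition heis_op x b : A :=
  tlift (fun (a : A) (p : dual A) => (p b : k) *: a) (x : tensor A (dual A)).

Fact heis_op_linear x : linear (heis_op x).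
Proof.
apply: tlift_linear => a p c b b'.
by rewrite linearP /= scalerDl scalerA.
Qed.

HB.instance Definition _ x :=
  GRing.isLinear.Build k A A *:%R (heis_op x) (heis_op_linear x).

Lemma heis_op_inj x y : heis_op x =1 heis_op y -> x = y.
Proof.
move=> eq_op; apply/eqP; rewrite -subr_eq0; apply/eqP.
have {eq_op}: forall b, heis_op (x - y) b = 0.
  move=> b; rewrite /heis_op linearB /= -/(heis_op x b) -/(heis_op y b).
  by rewrite eq_op subrr.
move: (x - y) => {x y}t t0; apply/matrixP => i j; rewrite mxE.
pose w i' : dual A := \sum_j' t i' j' *: r2v (delta_mx 0 j').
suff w0: w i = 0 by rewrite (r2v_sum0 w0).
apply/dualP => b; rewrite zero_lfunE.
apply: (@r2v_sum0 _ A (fun i' => w i' b)).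
rewrite -[RHS](t0 b); apply: eq_bigr => i' _.
rewrite sum_lfunE scaler_suml; apply: eq_bigr => j' _.
by rewrite scale_lfunE scalerA.
Qed.

Let op_tens a p b : heis_op (tens a p) b = (p b : k) *: a.
Proof.
rewrite /heis_op tliftE //; split=> [q c u v|u c q q'] /=.
  by rewrite scalerDr !scalerA mulrC.
by rewrite dual_linE scalerDl scalerA.
Qed.

Lemma heis_op_mul x y : heis_op (heis_mul x y) =1 star (heis_op x) (heis_op y).
Proof.
move=> b; pose F b1 b2 a p p' (g1 g2 : A) : A :=
  (p' b2 : k) *: ((p (g2 * b1) : k) *: (a * g1 : A)).
transitivity (tlift (fun a p => tlift (fun a' p' => tlift (fun b1 b2 =>
    tlift (F b1 b2 a p p') (comul a')) (comul b)) y) x).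
  rewrite {1}/heis_op /heis_mul tliftC; apply: eq_tlift => a p /=.
  rewrite tliftC; apply: eq_tlift => a' p' /=; rewrite tliftC /=.
  transitivity (tlift (fun p1 p2 : dual A => tlift (fun b1 b2 =>
      tlift (fun g1 g2 : A =>
        (p1 g2 * p2 b1 : k) *: ((p' b2 : k) *: (a * g1))) (comul a')) (comul b))
      (dual_comul p)).
    apply: eq_tlift => p1 p2; rewrite -/(heis_op _ _) op_tens dualM.
    rewrite tliftZl; apply: eq_tlift => b1 b2; rewrite /dual_act tliftMr tliftZr.
    apply: eq_tlift => g1 g2; rewrite -scalerAr !scalerA; congr (_ *: _).
    by rewrite mulrC mulrA.
  rewrite exchange_tlift; apply: eq_tlift => b1 b2.
  rewrite exchange_tlift; apply: eq_tlift => g1 g2.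
  by rewrite -tliftZl dual_comulE /F !scalerA mulrC.
rewrite exchange_tlift.
under eq_tlift do rewrite exchange_tlift.
rewrite exchange_tlift; apply: eq_tlift => b1 b2.
rewrite {2}/heis_op (tliftC comul) (tliftC (tlift _)) /=; apply: eq_tlift => a' p' /=.
rewrite !linearZ /= tliftZr exchange_tlift; apply: eq_tlift => g1 g2.
rewrite /heis_op tliftMl tliftZr; apply: eq_tlift => a p.
by rewrite -scalerAl.
Qed.

Let heis_op1 : heis_op heis_one =1 @counit_one k A.
Proof. by move=> b; rewrite op_tens. Qed.

Fact heis_mulA : associative heis_mul.
Proof.
move=> x y z; apply: heis_op_inj => b; rewrite heis_op_mul.
rewrite (eq_star (frefl _) (heis_op_mul y z)) -starA.
by rewrite -(eq_star (heis_op_mul x y) (frefl _)) -heis_op_mul.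
Qed.

Fact heis_mul1l : left_id heis_one heis_mul.
Proof.
move=> x; apply: heis_op_inj => b; rewrite heis_op_mul.
by rewrite (eq_star heis_op1 (frefl _)) star1l.
Qed.

Fact heis_mul1r : right_id heis_one heis_mul.
Proof.
move=> x; apply: heis_op_inj => b; rewrite heis_op_mul.
by rewrite (eq_star (frefl _) heis_op1) star1r.
Qed.

Fact heis_mul_linearl z : linear (heis_mul^~ z).
Proof. by move=> c x y; rewrite /heis_mul linearP. Qed.

Fact heis_mul_linearr z : linear (heis_mul z).
Proof. by apply: tlift_linear => a p c x y; rewrite linearP. Qed.

Fact heis_mulDl : left_distributive heis_mul +%R.
Proof. by move=> x y z; have := heis_mul_linearl z 1 x y; rewrite !scale1r. Qed.

Fact heis_mulDr : right_distributive heis_mul +%R.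
Proof. by move=> x y z; have := heis_mul_linearr x 1 y z; rewrite !scale1r. Qed.

Fact heis_one_neq0 : heis_one != 0.
Proof.
apply/eqP => one0; have := op_tens 1 1 1.
rewrite -[tens _ _]/heis_one one0 /heis_op linear0 counit1 scale1r => /esym/eqP.
by rewrite oner_eq0.
Qed.

HB.instance Definition _ := GRing.Zmodule_isNzRing.Build heisenberg
  heis_mulA heis_mul1l heis_mul1r heis_mulDl heis_mulDr heis_one_neq0.

Fact heis_scaleAl (c : k) x y : c *: (x * y) = (c *: x) * y.
Proof.
have := heis_mul_linearl y c x 0.
by rewrite addr0 (mul0r y : heis_mul 0 y = 0) addr0 => /esym.
Qed.

HB.instance Definition _ :=
  GRing.Lmodule_isLalgebra.Build k heisenberg heis_scaleAl.

Fact heis_scaleAr (c : k) x y : c *: (x * y) = x * (c *: y).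
Proof.
have := heis_mul_linearr x c y 0.
by rewrite addr0 (mulr0 x : heis_mul x 0 = 0) addr0 => /esym.
Qed.

HB.instance Definition _ :=
  GRing.Lalgebra_isAlgebra.Build k heisenberg heis_scaleAr.

End Heisenberg.

Section BimoduleAlgebra.
Variables (k : fieldType) (H : hopfAlgType k).

Record bimod_algebra (K : algType k) := BimodAlgebra {
  lact : H -> K -> K;
  ract : K -> H -> K;
  lact_bilinear : bilinear_for *:%R *:%R lact;
  ract_bilinear : bilinear_for *:%R *:%R ract;
  lact1 : forall x, lact 1 x = x;
  lactA : forall g h x, lact (g * h) x = lact g (lact h x);
  ract1 : forall x, ract x 1 = x;
  ractA : forall x g h, ract x (g * h) = ract (ract x g) h;
  lractA : forall g x h, ract (lact g x) h = lact g (ract x h);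
  lact_mul : forall h x y,
    lact h (x * y) = tlift (fun h1 h2 => lact h1 x * lact h2 y) (comul h);
  ract_mul : forall x y h,
    ract (x * y) h = tlift (fun h1 h2 => ract x h1 * ract y h2) (comul h);
  lact_one : forall h, lact h 1 = (counit h : k)%:A;
  ract_one : forall h, ract 1 h = (counit h : k)%:A
}.

Definition bimod_algebra_morphism (K L : algType k)
    (M : bimod_algebra K) (N : bimod_algebra L) (f : {lrmorphism K -> L}) :=
  (forall h x, f (lact M h x) = lact N h (f x)) /\
  (forall x h, f (ract M x h) = ract N (f x) h).

Definition dual_lact (h : H) (p : dual H) : dual H := (p \o amulr h)%VF.

Definition dual_ract (p : dual H) (h : H) : dual H := (p \o amull h)%VF.

Lemma dual_lactE h p x : dual_lact h p x = p (x * h).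
Proof. by rewrite comp_lfunE lfunE. Qed.

Lemma dual_ractE h p x : dual_ract p h x = p (h * x).
Proof. by rewrite comp_lfunE lfunE. Qed.

Let dual_tliftE (B : H -> H -> dual H) t x :
  tlift B t x = tlift (fun u v => B u v x) t.
Proof.
rewrite /tlift sum_lfunE; apply: eq_bigr => i _; rewrite sum_lfunE.
by apply: eq_bigr => j _; rewrite scale_lfunE.
Qed.

Let dual_mulP (p q : dual H) :
  bilinear_for *:%R *:%R (fun x y => p x * q y : k^o).
Proof.
split=> [y|x] c u v; rewrite /= dual_linear scale_regular.
  by rewrite mulrDl mulrA.
by rewrite mulrDr; congr (_ + _); rewrite !mulrA [_ * c]mulrC.
Qed.

Fact dual_lact_bilinear : bilinear_for *:%R *:%R dual_lact.
Proof.
split=> [p c g h|h c p q]; apply/dualP => x.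
  by rewrite dual_linE !dual_lactE mulrDr -scalerAr dual_linear.
by rewrite dual_linE !dual_lactE dual_linE.
Qed.

Fact dual_ract_bilinear : bilinear_for *:%R *:%R dual_ract.
Proof.
split=> [h c p q|p c g h]; apply/dualP => x.
  by rewrite dual_linE !dual_ractE dual_linE.
by rewrite dual_linE !dual_ractE mulrDl -scalerAl dual_linear.
Qed.

Fact dual_lact1 p : dual_lact 1 p = p.
Proof. by apply/dualP => x; rewrite dual_lactE mulr1. Qed.

Fact dual_lactA g h p : dual_lact (g * h) p = dual_lact g (dual_lact h p).
Proof. by apply/dualP => x; rewrite !dual_lactE mulrA. Qed.

Fact dual_ract1 p : dual_ract p 1 = p.
Proof. by apply/dualP => x; rewrite dual_ractE mul1r. Qed.

Fact dual_ractA p g h : dual_ract p (g * h) = dual_ract (dual_ract p g) h.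
Proof. by apply/dualP => x; rewrite !dual_ractE mulrA. Qed.

Fact dual_lractA g p h :
  dual_ract (dual_lact g p) h = dual_lact g (dual_ract p h).
Proof. by apply/dualP => x; rewrite !(dual_lactE, dual_ractE) mulrA. Qed.

Fact dual_lact_mul h p q :
  dual_lact h (p * q) =
  tlift (fun h1 h2 => dual_lact h1 p * dual_lact h2 q) (comul h).
Proof.
apply/dualP => x; rewrite dual_tliftE dual_lactE dualM sweedlerM //.
rewrite exchange_tlift; apply: eq_tlift => h1 h2; rewrite dualM.
by apply: eq_tlift => x1 x2; rewrite !dual_lactE.
Qed.

Fact dual_ract_mul p q h :
  dual_ract (p * q) h =
  tlift (fun h1 h2 => dual_ract p h1 * dual_ract q h2) (comul h).
Proof.
apply/dualP => x; rewrite dual_tliftE dual_ractE dualM sweedlerM //.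
apply: eq_tlift => h1 h2; rewrite dualM.
by apply: eq_tlift => x1 x2; rewrite !dual_ractE.
Qed.

Fact dual_lact_one h : dual_lact h 1 = (counit h : k)%:A.
Proof.
apply/dualP => x; rewrite dual_lactE scale_lfunE counitM scale_regular.
exact: mulrC.
Qed.

Fact dual_ract_one h : dual_ract 1 h = (counit h : k)%:A.
Proof. by apply/dualP => x; rewrite dual_ractE scale_lfunE counitM. Qed.

Definition dual_bimod : bimod_algebra (dual H) :=
  BimodAlgebra dual_lact_bilinear dual_ract_bilinear dual_lact1 dual_lactA
    dual_ract1 dual_ractA dual_lractA dual_lact_mul dual_ract_mul
    dual_lact_one dual_ract_one.

End BimoduleAlgebra.

Arguments dual_bimod {k} H.

Definition dual_antipode (k : fieldType) (H : hopfAlgType k) (p : dual H) :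
  dual H := (p \o antipode)%VF.

Record vertex_group (k : fieldType) (H : cocommHopfAlgType k) (K : algType k) :=
  VertexGroup {
  vg_bimod : bimod_algebra H K;
  vg_alpha : {lrmorphism dual H -> K};
  vg_alpha_bimod : bimod_algebra_morphism (dual_bimod H) vg_bimod vg_alpha;
  vg_tau : {linear K -> K};
  vg_tau_bij : bijective vg_tau;
  vg_tau1 : vg_tau 1 = 1;
  vg_tauM : forall x y, vg_tau (x * y) = vg_tau y * vg_tau x;
  vg_tau_alpha : forall p, vg_tau (vg_alpha p) = vg_alpha (dual_antipode p);
  vg_tau_lact : forall h x,
    vg_tau (lact vg_bimod h x) = ract vg_bimod (vg_tau x) (antipode h);
  vg_tau_ract : forall x h,
    vg_tau (ract vg_bimod x h) = lact vg_bimod (antipode h) (vg_tau x)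
}.

(* Main.v *)
Require Import Defs.
From mathcomp Require Import all_boot all_order all_algebra all_field.
From HB Require Import structures.

Set Implicit Arguments.
Unset Strict Implicit.
Unset Printing Implicit Defensive.

Import GRing.Theory VectorInternalTheory.
Local Open Scope ring_scope.

(** Throughout, S is the antipode, p ↼ h is the functional p (h * _), and
    indices as in a_1, a_2 are Sweedler indices.

    The Heisenberg double acts on A by (a # p) . c = a (p ⇀ c). This action is
    multiplicative ([heis_actM]) and identifies A # A^* with the algebra of all
    linear endomorphisms of A ([heis_act_inj], [heis_act_of_endo]). The algebra
    is generated by its copies a # 1 of A and 1 # p of A^*, which are
    [heis_left] and [heis_dual], subject to the commutation rule
    (1 # p) (a # 1) = (a_1 # 1) (1 # p ↼ a_2) of [heis_dual_left].

    Cocommutativity makes S an involution compatible with products and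
    coproducts, and this gives two symmetries of A # A^*.

    - Conjugating an endomorphism of A by S is an involutive automorphism theta
      of A # A^* ([heis_conj]). It fixes the copy of A^* as a subset, where it
      is S, and it turns the left multiplication by a into the right
      multiplication by S(a). So theta moves the copy of A to one that commutes
      with it ([heis_left_conjC]).

    - Since A^* is commutative, the commutation rule is compatible with
      reversing products, if a is replaced by S(a): the map
      a # p |-> (1 # p) (S(a) # 1) is an involutive anti-automorphism omega
      ([heis_transpose]).

    An algebra morphism l from a Hopf algebra to K always makes K a right
    module algebra, by x · h = l(S(h_1)) x l(h_2) ([right_adjoint]). For
    K = A # A^* and l the inclusion of A this is the right action. The left
    action is its image under theta, h · x = theta (theta(x) · S(h)). It is
    built from right multiplications and the right action from left
    multiplications, so the two commute. On the copy of A^* they are the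
    regular actions ([heis_ract_dual], [heis_lact_dual]), hence p |-> 1 # p is
    a morphism of bimodule algebras.

    Finally tau = theta omega. It sends 1 # p to 1 # S(p), since omega fixes
    1 # p. The map omega commutes with both actions ([heis_transpose_ract],
    [heis_transpose_lact]), while theta exchanges them up to S by construction
    of the left action, hence tau exchanges them up to S. Being a composite of
    involutions, tau is bijective. *)

(** * Multilinearity of Sweedler expressions *)
Section MultilinearityRules.
Variables (k : fieldType) (U W : lmodType k).

Lemma linear_id : linear (fun u : U => u).
Proof. by []. Qed.

Lemma linear_mul_left (K : algType k) (g : U -> K) (x : K) :
  linear g -> linear (fun u => g u * x).
Proof. by move=> g_lin c u v; rewrite g_lin mulrDl -scalerAl. Qed.

Lemma linear_mul_right (K : algType k) (g : U -> K) (x : K) :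
  linear g -> linear (fun u => x * g u).
Proof. by move=> g_lin c u v; rewrite g_lin mulrDr -scalerAr. Qed.

Lemma linear_scale_left (g : U -> k^o) (w : W) :
  linear g -> linear (fun u => (g u : k) *: w).
Proof. by move=> g_lin c u v; rewrite g_lin scalerDl scalerA. Qed.

Lemma linear_scale_right (c : k) (g : U -> W) :
  linear g -> linear (fun u => c *: g u).
Proof. by move=> g_lin d u v; rewrite g_lin scalerDr !scalerA mulrC. Qed.

Lemma linear_tens_left (V V' : vectType k) (g : U -> V) (v : V') :
  linear g -> linear (fun u => tens (g u) v).
Proof. by move=> g_lin c u u'; rewrite g_lin (tens_is_bilinear _ _).1. Qed.

Lemma linear_tens_right (V V' : vectType k) (g : U -> V') (v : V) :
  linear g -> linear (fun u => tens v (g u)).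
Proof. by move=> g_lin c u u'; rewrite g_lin (tens_is_bilinear _ _).2. Qed.

Lemma linear_dual_apply (V : vectType k) (g : U -> dual V) (v : V) :
  linear g -> linear (fun u => g u v : k^o).
Proof. by move=> g_lin c u u'; rewrite g_lin add_lfunE scale_lfunE. Qed.

Lemma linear_compose (V : lmodType k) (f : U -> W) (g : V -> U) :
  linear f -> linear g -> linear (fun u => f (g u)).
Proof. by move=> f_lin g_lin c u v; rewrite g_lin f_lin. Qed.

End MultilinearityRules.

Section DualLinearity.
Variables (k : fieldType) (U : lmodType k) (A : hopfAlgType k).

Lemma linear_dual_ract_left (g : U -> dual A) (a : A) :
  linear g -> linear (fun u => dual_ract (g u) a).
Proof. by move=> g_lin c u v; rewrite g_lin (dual_ract_bilinear A).1. Qed.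

Lemma linear_dual_ract_right (g : U -> A) (p : dual A) :
  linear g -> linear (fun u => dual_ract p (g u)).
Proof. by move=> g_lin c u v; rewrite g_lin (dual_ract_bilinear A).2. Qed.

Lemma linear_dual_act_left (g : U -> dual A) (a : A) :
  linear g -> linear (fun u => dual_act (g u) a).
Proof.
move=> g_lin; apply: tlift_linear => x y.
by apply: linear_scale_left; apply: linear_dual_apply.
Qed.

Lemma linear_dual_act_right (g : U -> A) (p : dual A) :
  linear g -> linear (fun u => dual_act p (g u)).
Proof. exact: linear_sweedler. Qed.

End DualLinearity.

(** These take a bare function with a proof of linearity, since the maps to push
    through a Sweedler sum are expressions with one variable abstracted. *)
Section LinearHypothesis.
Variables (k : fieldType) (V W : lmodType k) (f : V -> W).
Hypothesis f_lin : linear f.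

Let F : {linear V -> W} := HB.pack f (GRing.isLinear.Build k V W *:%R f f_lin).

Lemma linear_scale c v : f (c *: v) = c *: f v.
Proof. by rewrite -[LHS]/(F _) linearZ. Qed.

Lemma linear_tlift (U U' : vectType k) (B : U -> U' -> V) t :
  f (tlift B t) = tlift (fun u v => f (B u v)) t.
Proof. exact: (tliftC F). Qed.

End LinearHypothesis.

(** Proves that an expression is linear, bilinear or trilinear by following its
    syntax: the variable must sit under exactly one branch of each product. The
    last rule uses linearity hypotheses of the context. *)
Ltac multilinear :=
  try (split; intros);
  repeat first
    [ exact: linear_id
    | apply: tlift_linear => ? ?
    | apply: linear_sweedler
    | apply: linear_mul_left | apply: linear_mul_right
    | apply: linear_scale_left | apply: linear_scale_right
    | apply: linear_tens_left | apply: linear_tens_right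
    | apply: linear_dual_apply
    | apply: linear_dual_ract_left | apply: linear_dual_ract_right
    | apply: linear_dual_act_left | apply: linear_dual_act_right
    | apply: linear_comp
    | match goal with
        f_lin : linear _ |- _ => apply: (linear_compose f_lin)
      end ].

(** * The antipode of a Hopf algebra *)
Section Antipode.
Variables (k : fieldType) (A : hopfAlgType k).
Implicit Types a b : A.

Lemma antipode1 : antipode (1 : A) = 1.
Proof.
have := antipodel (1 : A); rewrite sweedler1; last by multilinear.
by rewrite mulr1 counit1 scale1r.
Qed.

Section Contractions.
Variables (W : lmodType k) (f : A -> W).
Hypothesis f_lin : linear f.

Lemma tlift_counitl a :
  tlift (fun x y => (counit x : k) *: f y) (comul a) = f a.
Proof.
rewrite -[in RHS](counitl a) linear_tlift //.
by apply: eq_tlift => x y; rewrite linear_scale.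
Qed.

Lemma tlift_counitr a :
  tlift (fun x y => (counit y : k) *: f x) (comul a) = f a.
Proof.
rewrite -[in RHS](counitr a) linear_tlift //.
by apply: eq_tlift => x y; rewrite linear_scale.
Qed.

Lemma tlift_antipodel a :
  tlift (fun x y => f (antipode x * y)) (comul a) = (counit a : k) *: f 1.
Proof. by rewrite -linear_tlift // antipodel linear_scale. Qed.

Lemma tlift_antipoder a :
  tlift (fun x y => f (x * antipode y)) (comul a) = (counit a : k) *: f 1.
Proof. by rewrite -linear_tlift // antipoder linear_scale. Qed.

End Contractions.

Arguments tlift_counitl {W} f.
Arguments tlift_counitr {W} f.
Arguments tlift_antipodel {W} f.
Arguments tlift_antipoder {W} f.

Lemma counit_antipode a : counit (antipode a) = counit a.
Proof.
have /= := tlift_antipodel (fun x => counit x) _ a.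
rewrite counit1 scale_regular mulr1 => <-; last by multilinear.
rewrite -[LHS](tlift_counitr (fun x => counit (antipode x)));
  last by multilinear.
by apply: eq_tlift => x y; rewrite counitM scale_regular mulrC.
Qed.

(** The map (a, b) |-> S(ab) is a left convolution inverse of the product
    A ⊗ A -> A, and (a, b) |-> S(b) S(a) is a right one. *)
Lemma antipodeM a b : antipode (a * b) = antipode b * antipode a.
Proof.
(* Both sides are the sum of S(a_1 b_1) (a_2 b_2) (S(b_3) S(a_3)). *)
pose T (x1 x2 x3 y1 y2 y3 : A) :=
  antipode (x1 * y1) * (x2 * y2) * (antipode y3 * antipode x3).
have T3 x1 x2 x3 : trilinear (T x1 x2 x3) by multilinear.
pose T' x1 x2 x3 :=
  tlift (fun y1 y => tlift (T x1 x2 x3 y1) (comul y)) (comul b).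
have T'3 : trilinear T' by multilinear.
transitivity (tlift (fun x1 x => tlift (T' x1) (comul x)) (comul a)).
  rewrite -[LHS](tlift_counitr (fun x => antipode (x * b)));
    last by multilinear.
  apply: eq_tlift => x1 x; rewrite /T' exchange_tlift.
  rewrite -[antipode _](tlift_counitr (fun y => antipode (x1 * y)));
    last by multilinear.
  rewrite tliftZr; apply: eq_tlift => y1 y.
  transitivity (tlift (fun x2 x3 =>
      counit y *: (antipode (x1 * y1) * (x2 * antipode x3))) (comul x)).
    rewrite (tlift_antipoder (fun u => counit y *: (antipode (x1 * y1) * u)));
      last by multilinear.
    by rewrite mulr1.
  apply: eq_tlift => x2 x3.
  rewrite -[x2 in LHS]mulr1.
  rewrite -(tlift_antipoder (fun u =>
    antipode (x1 * y1) * (x2 * u * antipode x3))); last by multilinear.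
  by apply: eq_tlift => y2 y3; rewrite /T !mulrA.
rewrite sweedlerA //.
rewrite -[in RHS](tlift_counitl (fun x => antipode b * antipode x));
  last by multilinear.
apply: eq_tlift => x x3.
under eq_tlift do rewrite /T' sweedlerA //.
rewrite exchange_tlift.
rewrite -[antipode b](tlift_counitl (fun y => antipode y)); last by multilinear.
rewrite tliftMl tliftZr; apply: eq_tlift => y y3.
rewrite -scalerAl scalerA -counitM.
transitivity (tlift (fun z1 z2 =>
    antipode z1 * z2 * (antipode y3 * antipode x3)) (comul (x * y))).
  by rewrite sweedlerM //; multilinear.
rewrite (tlift_antipodel (fun u => u * (antipode y3 * antipode x3)));
  last by multilinear.
by rewrite mul1r.
Qed.

(** The coproduct of S(a) is S(a_2) ⊗ S(a_1), as both a |-> S(a)_1 ⊗ S(a)_2 and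
    a |-> S(a_2) ⊗ S(a_1) are convolution inverses of the coproduct
    A -> A ⊗ A. *)
Lemma sweedler_antipode (W : lmodType k) (B : A -> A -> W) a :
  bilinear_for *:%R *:%R B ->
  tlift B (comul (antipode a)) =
  tlift (fun x y => B (antipode y) (antipode x)) (comul a).
Proof.
case=> Bl Br.
have BL (f : A -> A) y : linear f -> linear (fun x => B (f x) y).
  by move=> f_lin c u v; rewrite f_lin; apply: Bl.
have BR (f : A -> A) y : linear f -> linear (fun x => B y (f x)).
  by move=> f_lin c u v; rewrite f_lin; apply: Br.
(* Both sides are the sum of
   B (S(a_1)_1 a_2 S(a_5)) (S(a_1)_2 a_3 S(a_4)), computed by G on the splitting
   of a into a_1, then a_2 and a_3, then a_4 and a_5. *)
pose H u v p q r s := B (u * p * antipode s) (v * q * antipode r).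
pose G x y z := tlift (fun u v => tlift (fun p q =>
  tlift (H u v p q) (comul z)) (comul y)) (comul (antipode x)).
have H3 u v p : trilinear (H u v p).
  by split=> *; [apply: BR|apply: BR|apply: BL]; multilinear.
have H3' u v : trilinear (fun p q z => tlift (H u v p q) (comul z)).
  split=> *; last by multilinear.
    by apply: tlift_linear => ? ?; apply: BL; multilinear.
  by apply: tlift_linear => ? ?; apply: BR; multilinear.
have G3 : trilinear G by multilinear.
transitivity (tlift (fun x w => tlift (G x) (comul w)) (comul a)).
  rewrite -[LHS](tlift_counitr (fun x => tlift B (comul (antipode x))));
    last by multilinear.
  apply: eq_tlift => x w; rewrite tliftZr exchange_tlift.
  apply: eq_tlift => u v; rewrite -(sweedlerA _ (H3' u v)).
  rewrite -[in LHS](mulr1 u).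
  rewrite -(tlift_antipoder (fun z => B (u * z) v));
    last by apply: BL; multilinear.
  apply: eq_tlift => p y; rewrite sweedlerA //.
  rewrite -(tlift_counitl (fun y => B (u * (p * antipode y)) v));
    last by apply: BL; multilinear.
  apply: eq_tlift => x' s.
  rewrite -[v in LHS]mulr1 -(tlift_antipoder (fun z => B _ (v * z)));
    last by apply: BR; multilinear.
  by apply: eq_tlift => q r; rewrite /H !mulrA.
rewrite sweedlerA //.
rewrite -[RHS](tlift_counitl (fun z =>
  tlift (fun x y => B (antipode y) (antipode x)) (comul z)));
  last by multilinear.
apply: eq_tlift => w z; rewrite tliftZr.
pose K w r s :=
  tlift (fun p q => B (p * antipode s) (q * antipode r)) (comul w).
transitivity (tlift (fun x y =>
    tlift (K (antipode x * y)) (comul z)) (comul w)).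
  apply: eq_tlift => x y.
  transitivity (tlift (fun r s => tlift (fun u v => tlift (fun p q =>
    H u v p q r s) (comul y)) (comul (antipode x))) (comul z)).
    by rewrite exchange_tlift; apply: eq_tlift => u v; rewrite exchange_tlift.
  apply: eq_tlift => r s; rewrite /K sweedlerM //.
  by split=> *; [apply: BL | apply: BR]; multilinear.
rewrite (tlift_antipodel (fun x => tlift (K x) (comul z))); last by multilinear.
rewrite tliftZr; apply: eq_tlift => r s; rewrite /K sweedler1 ?mul1r //.
by split=> *; [apply: BL | apply: BR]; multilinear.
Qed.

End Antipode.

Arguments tlift_counitl {k A W} f.
Arguments tlift_counitr {k A W} f.
Arguments tlift_antipodel {k A W} f.
Arguments tlift_antipoder {k A W} f.

(** * The antipode of a cocommutative Hopf algebra *)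
Section CocommutativeAntipode.
Variables (k : fieldType) (A : cocommHopfAlgType k).
Implicit Types a b : A.

Lemma sweedlerC (W : lmodType k) (B : A -> A -> W) a :
  bilinear_for *:%R *:%R B ->
  tlift B (comul a) = tlift (fun x y => B y x) (comul a).
Proof.
move=> Bbl; rewrite -{1}[comul a]comulC /tflip (tliftC (tlift B)).
by apply: eq_tlift => x y; rewrite /= tliftE.
Qed.

Lemma tlift_antipodel_flip (W : lmodType k) (f : A -> W) a : linear f ->
  tlift (fun x y => f (antipode y * x)) (comul a) = (counit a : k) *: f 1.
Proof.
by move=> f_lin; rewrite -tlift_antipodel // [RHS]sweedlerC //; multilinear.
Qed.

Lemma tlift_antipoder_flip (W : lmodType k) (f : A -> W) a : linear f ->
  tlift (fun x y => f (y * antipode x)) (comul a) = (counit a : k) *: f 1.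
Proof.
by move=> f_lin; rewrite -tlift_antipoder // [RHS]sweedlerC //; multilinear.
Qed.

Arguments tlift_antipodel_flip {W} f.
Arguments tlift_antipoder_flip {W} f.

Lemma sweedler_antipode_cocomm (W : lmodType k) (B : A -> A -> W) a :
  bilinear_for *:%R *:%R B ->
  tlift B (comul (antipode a)) =
  tlift (fun x y => B (antipode x) (antipode y)) (comul a).
Proof.
move=> Bbl; have [Bl Br] := Bbl.
rewrite sweedler_antipode // sweedlerC //.
split=> ? c u v; rewrite /= linearP; [exact: Br | exact: Bl].
Qed.

(** Both S(S(a)) and a are convolution inverses of S: this is
    S(S(a_1)) S(a_2) a_3 contracted in two ways, where
    S(S(a_1)) S(a_2) = S(a_2 S(a_1)) and cocommutativity contracts a_2 S(a_1). *)
Lemma antipodeK a : antipode (antipode a) = a.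
Proof.
pose T x y z : A := antipode (antipode x) * antipode y * z.
have T3 : trilinear T by multilinear.
transitivity (tlift (fun x y => tlift (T x) (comul y)) (comul a)).
  rewrite -[LHS](tlift_counitr (fun x => antipode (antipode x)));
    last by multilinear.
  apply: eq_tlift => x y; rewrite -[antipode _]mulr1.
  rewrite -(tlift_antipodel (fun z => antipode (antipode x) * z));
    last by multilinear.
  by apply: eq_tlift => u v; rewrite mulrA.
rewrite sweedlerA // -[RHS]counitl; apply: eq_tlift => w z.
rewrite -[z in RHS]mul1r -antipode1.
rewrite -(tlift_antipoder_flip (fun x => antipode x * z)); last by multilinear.
by apply: eq_tlift => x y; rewrite antipodeM /T.
Qed.

End CocommutativeAntipode.

Arguments tlift_antipodel_flip {k A W} f.
Arguments tlift_antipoder_flip {k A W} f.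

(** * Generators of the Heisenberg double *)
Section HeisenbergGenerators.
Variables (k : fieldType) (A : hopfAlgType k).
Implicit Types (a b c : A) (p q : dual A) (x y : heisenberg A).

Lemma dual_tliftE (U V : vectType k) (B : U -> V -> dual A) t a :
  tlift B t a = tlift (fun u v => B u v a : k^o) t.
Proof.
rewrite /tlift sum_lfunE; apply: eq_bigr => i _; rewrite sum_lfunE.
by apply: eq_bigr => j _; rewrite scale_lfunE.
Qed.

Lemma linear_heis_ext (W : lmodType k) (f g : heisenberg A -> W) :
  linear f -> linear g -> (forall a p, f (tens a p) = g (tens a p)) -> f =1 g.
Proof.
move=> f_lin g_lin eqfg x; rewrite -(tensorK (x : tensor _ _)).
rewrite (linear_tlift (f_lin : linear (f : tensor _ _ -> W))).
rewrite (linear_tlift (g_lin : linear (g : tensor _ _ -> W))).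
by apply: eq_tlift => a p; apply: eqfg.
Qed.

(** The product without the coproduct of A^*: in a (p_1 ⇀ b) # p_2 q the
    functional p only enters through p_1 (b_2) p_2 = p ↼ b_2. *)
Lemma heis_mul_tens a p b q :
  (tens a p : heisenberg A) * (tens b q : heisenberg A) =
  tlift (fun b1 b2 => tens (a * b1) (dual_ract p b2 * q)) (comul b)
    :> heisenberg A.
Proof.
rewrite [LHS]heis_mulE.
transitivity (tlift (fun p1 p2 : dual A => tlift (fun b1 b2 =>
    tens (a * b1) ((p1 b2 : k) *: (p2 * q))) (comul b)) (dual_comul p)).
  apply: eq_tlift => p1 p2; rewrite /dual_act.
  rewrite (linear_tlift (f := fun u => tens (a * u) (p2 * q)));
    last by multilinear.
  apply: eq_tlift => b1 b2.
  rewrite (linear_scale (f := fun u => tens (a * u) (p2 * q)));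
    last by multilinear.
  by rewrite (linear_scale (f := fun u => tens (a * b1) u));
    last by multilinear.
rewrite exchange_tlift; apply: eq_tlift => b1 b2.
transitivity (tens (a * b1)
    (tlift (fun p1 p2 : dual A => (p1 b2 : k) *: p2) (dual_comul p) * q)).
  rewrite (linear_tlift (f := fun u => tens (a * b1) (u * q)));
    last by multilinear.
  by apply: eq_tlift => p1 p2; rewrite -scalerAl.
congr (tens _ (_ * q)); apply/dualP => c.
rewrite dual_tliftE dual_ractE -dual_comulE; apply: eq_tlift => p1 p2.
by rewrite scale_lfunE.
Qed.

Definition heis_left a : heisenberg A := tens a (1 : dual A).
Definition heis_dual p : heisenberg A := tens (1 : A) p.

Lemma heis_left_mul a b p :
  heis_left a * (tens b p : heisenberg A) = tens (a * b) p :> heisenberg A.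
Proof.
rewrite heis_mul_tens -[RHS](tlift_counitr (fun b => tens (a * b) p));
  last by multilinear.
apply: eq_tlift => b1 b2; rewrite dual_ract_one -scalerAl mul1r.
by rewrite (linear_scale (f := fun u => tens (a * b1) u)); last by multilinear.
Qed.

Lemma heis_mul_dual a p q :
  (tens a p : heisenberg A) * heis_dual q = tens a (p * q) :> heisenberg A.
Proof.
rewrite heis_mul_tens sweedler1 ?mulr1 ?dual_ract1 //.
by multilinear.
Qed.

Lemma heis_tens a p : tens a p = heis_left a * heis_dual p.
Proof. by rewrite heis_left_mul mulr1. Qed.

Fact heis_left_linear : linear heis_left.
Proof. by move=> c a b; rewrite /heis_left (tens_is_bilinear _ _).1. Qed.

Fact heis_dual_linear : linear heis_dual.
Proof. by move=> c a b; rewrite /heis_dual (tens_is_bilinear _ _).2. Qed.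

Fact heis_left_monoid : monoid_morphism heis_left.
Proof. by split=> // a b; rewrite heis_left_mul. Qed.

Fact heis_dual_monoid : monoid_morphism heis_dual.
Proof. by split=> // p q; rewrite heis_mul_dual. Qed.

HB.instance Definition _ := GRing.isLinear.Build k A (heisenberg A) *:%R
  heis_left heis_left_linear.
HB.instance Definition _ := GRing.isMonoidMorphism.Build A (heisenberg A)
  heis_left heis_left_monoid.
HB.instance Definition _ := GRing.isLinear.Build k (dual A) (heisenberg A) *:%R
  heis_dual heis_dual_linear.
HB.instance Definition _ := GRing.isMonoidMorphism.Build (dual A) (heisenberg A)
  heis_dual heis_dual_monoid.


Lemma heis_dual_left p a : heis_dual p * heis_left a =
  tlift (fun a1 a2 => heis_left a1 * heis_dual (dual_ract p a2)) (comul a).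
Proof.
rewrite [LHS]heis_mul_tens; apply: eq_tlift => a1 a2.
by rewrite -heis_tens mul1r mulr1.
Qed.

End HeisenbergGenerators.

(** * The anti-automorphism a # p |-> (1 # p) (S(a) # 1) *)
Section HeisenbergTranspose.
Variables (k : fieldType) (A : cocommHopfAlgType k).
Implicit Types (a b c : A) (p q : dual A) (s t : heisenberg A).

Lemma dual_mulC p q : p * q = q * p.
Proof.
apply/dualP => a; rewrite !dualM sweedlerC; last by multilinear.
by apply: eq_tlift => u v; rewrite mulrC.
Qed.

(** The commutation rule solved for the other order of the factors: moving
    p ↼ S(a_3) back over a_1 produces p ↼ (S(a_3) a_2), which contracts. *)
Lemma heis_left_dual a p : heis_left a * heis_dual p =
  tlift (fun a1 a2 =>
    heis_dual (dual_ract p (antipode a2)) * heis_left a1) (comul a).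
Proof.
pose T (x y z : A) := heis_left x * heis_dual (dual_ract p (antipode z * y)).
have T3 : trilinear T by multilinear.
transitivity (tlift (fun x y => tlift (T x) (comul y)) (comul a)).
  rewrite -[LHS](tlift_counitr (fun x => heis_left x * heis_dual p));
    last by multilinear.
  apply: eq_tlift => x y.
  rewrite (tlift_antipodel_flip (fun u =>
    heis_left x * heis_dual (dual_ract p u))); last by multilinear.
  by rewrite dual_ract1.
rewrite sweedlerA //; apply: eq_tlift => x z; rewrite heis_dual_left.
by apply: eq_tlift => u v; rewrite /T dual_ractA.
Qed.

Lemma heis_left_antipode_dual a p : heis_left (antipode a) * heis_dual p =
  tlift (fun a1 a2 =>
    heis_dual (dual_ract p a2) * heis_left (antipode a1)) (comul a).
Proof.
rewrite heis_left_dual sweedler_antipode_cocomm; last by multilinear.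
by apply: eq_tlift => u v; rewrite antipodeK.
Qed.

Definition heis_transpose s : heisenberg A :=
  tlift (fun a p => heis_dual p * heis_left (antipode a))
    (s : tensor A (dual A)).

Fact heis_transpose_linear : linear heis_transpose.
Proof. exact: tlift_is_linear. Qed.

HB.instance Definition _ := GRing.isLinear.Build k (heisenberg A) (heisenberg A)
  *:%R heis_transpose heis_transpose_linear.

Lemma heis_transpose_tens a p :
  heis_transpose (tens a p) = heis_dual p * heis_left (antipode a).
Proof. by rewrite /heis_transpose tliftE //; multilinear. Qed.

Lemma heis_transpose_left a :
  heis_transpose (heis_left a) = heis_left (antipode a).
Proof. by rewrite heis_transpose_tens rmorph1 mul1r. Qed.

Lemma heis_transpose_dual p : heis_transpose (heis_dual p) = heis_dual p.
Proof. by rewrite heis_transpose_tens antipode1 rmorph1 mulr1. Qed.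

(** Reversing the commutation rule and replacing a by S(a) turns it into
    [heis_left_antipode_dual]; the factors in A^* may be permuted freely as
    A^* is commutative. *)
Lemma heis_transposeM s t :
  heis_transpose (s * t) = heis_transpose t * heis_transpose s.
Proof.
move: s; apply: linear_heis_ext; [by multilinear|by multilinear|move=> a p].
move: t; apply: linear_heis_ext; [by multilinear|by multilinear|move=> b q].
rewrite heis_mul_tens (linear_tlift heis_transpose_linear) !heis_transpose_tens.
transitivity (heis_dual q * (heis_left (antipode b) * heis_dual p)
    * heis_left (antipode a)); last by rewrite !mulrA.
rewrite heis_left_antipode_dual tliftMr tliftMl; apply: eq_tlift => b1 b2.
by rewrite heis_transpose_tens antipodeM dual_mulC !rmorphM !mulrA.
Qed.

Lemma heis_transposeK : involutive heis_transpose.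
Proof.
apply: linear_heis_ext; [by multilinear|by multilinear|move=> a p].
rewrite heis_transpose_tens heis_transposeM heis_transpose_left.
by rewrite heis_transpose_dual antipodeK -heis_tens.
Qed.

End HeisenbergTranspose.

(** * The action of the Heisenberg double on A *)
Section HeisenbergRepresentation.
Variables (k : fieldType) (A : hopfAlgType k).
Implicit Types (a b c : A) (p q : dual A) (s t : heisenberg A).

Definition heis_act s c : A :=
  tlift (fun a p => a * dual_act p c) (s : tensor A (dual A)).

Fact heis_act_linear s : linear (heis_act s).
Proof. by multilinear. Qed.

Fact heis_act_linearl c : linear (heis_act^~ c).
Proof. exact: tlift_is_linear. Qed.

Lemma heis_act_tens a p c : heis_act (tens a p) c = a * dual_act p c.
Proof. by rewrite /heis_act tliftE //; multilinear. Qed.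

Lemma dual_act1 c : dual_act 1 c = c.
Proof. by rewrite -[RHS]counitr. Qed.

Lemma heis_act_left a c : heis_act (heis_left a) c = a * c.
Proof. by rewrite heis_act_tens dual_act1. Qed.

Lemma heis_act_dual p c : heis_act (heis_dual p) c = dual_act p c.
Proof. by rewrite heis_act_tens mul1r. Qed.

Lemma dual_act_mul p q c : dual_act (p * q) c = dual_act p (dual_act q c).
Proof.
pose T (x y z : A) := (p y : k) *: ((q z : k) *: x).
have T3 : trilinear T by multilinear.
transitivity (tlift (fun x y => tlift (T x) (comul y)) (comul c)).
  apply: eq_tlift => x y; rewrite dualM tliftZl.
  by apply: eq_tlift => u v; rewrite /T scalerA.
rewrite sweedlerA // {2}/dual_act.
rewrite (linear_tlift (f := dual_act p)); last by multilinear.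
apply: eq_tlift => x z.
rewrite (linear_scale (f := dual_act p)); last by multilinear.
rewrite tliftZr; apply: eq_tlift => u v.
by rewrite /T !scalerA mulrC.
Qed.

Lemma dual_act_prod p b c :
  dual_act p (b * c) =
  tlift (fun b1 b2 => b1 * dual_act (dual_ract p b2) c) (comul b).
Proof.
rewrite /dual_act sweedlerM; last by multilinear.
apply: eq_tlift => b1 b2; rewrite tliftMr; apply: eq_tlift => c1 c2.
by rewrite dual_ractE scalerAr.
Qed.

(** On generators this amounts to (p q) ⇀ c = p ⇀ (q ⇀ c) together with
    p ⇀ (b c) = b_1 ((p ↼ b_2) ⇀ c), the commutation rule of A # A^*. *)
Lemma heis_actM s t c : heis_act (s * t) c = heis_act s (heis_act t c).
Proof.
move: s; apply: (@linear_heis_ext _ _ _ (fun s => heis_act (s * t) c)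
  (fun s => heis_act s (heis_act t c))) => [||a p].
- by apply: (linear_compose (heis_act_linearl c)); multilinear.
- exact: heis_act_linearl.
move=> /=; move: t; apply: (@linear_heis_ext _ _ _
  (fun t => heis_act ((tens a p : heisenberg A) * t) c)
  (fun t => heis_act (tens a p) (heis_act t c))) => [||b q].
- by apply: (linear_compose (heis_act_linearl c)); multilinear.
- apply: (linear_compose (heis_act_linear (tens a p))).
  exact: heis_act_linearl.
rewrite !heis_act_tens dual_act_prod tliftMr heis_mul_tens.
rewrite (linear_tlift (heis_act_linearl c)); apply: eq_tlift => b1 b2.
by rewrite heis_act_tens dual_act_mul mulrA.
Qed.

Lemma heis_act1 c : heis_act 1 c = c.
Proof. by rewrite heis_act_dual dual_act1. Qed.

(** If an element of A # A^* is viewed as the linear map f given by [heis_op],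
    its action is c |-> f(c_2) c_1, the convolution of f with the identity in
    the opposite order. *)
Lemma heis_actE s c :
  heis_act s c = tlift (fun c1 c2 => heis_op s c2 * c1) (comul c).
Proof.
rewrite /heis_op; under [RHS]eq_tlift do rewrite tliftMl.
rewrite exchange_tlift; apply: eq_tlift => a p.
by rewrite tliftMr; apply: eq_tlift => u v; rewrite -scalerAl -scalerAr.
Qed.

End HeisenbergRepresentation.

(** * The Heisenberg double as an endomorphism algebra *)
Section HeisenbergEndomorphisms.
Variables (k : fieldType) (A : cocommHopfAlgType k).
Implicit Types (a b c : A) (p q : dual A) (s t : heisenberg A).

(** Convolution with the antipode undoes the convolution with the identity of
    [heis_actE], so that an element is determined by its action. *)
Lemma heis_opE s c :
  heis_op s c = tlift (fun c1 c2 => heis_act s c2 * antipode c1) (comul c).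
Proof.
pose T (x y z : A) := heis_op s z * (y * antipode x).
have T3 : trilinear T by multilinear.
transitivity (tlift (fun x y => tlift (T x) (comul y)) (comul c)).
  rewrite sweedlerA // -[LHS](tlift_counitl (heis_op s));
    last exact: heis_op_linear.
  apply: eq_tlift => x z.
  rewrite (tlift_antipoder_flip (fun u => heis_op s z * u));
    last by multilinear.
  by rewrite mulr1.
apply: eq_tlift => x y; rewrite heis_actE tliftMl.
by apply: eq_tlift => u v; rewrite /T mulrA.
Qed.

Lemma heis_act_inj s t : heis_act s =1 heis_act t -> s = t.
Proof.
move=> eqst; apply: heis_op_inj => c; rewrite !heis_opE.
by apply: eq_tlift => u v; rewrite eqst.
Qed.

(** The element acting as f: by [heis_opE] its operator must be
    c |-> f(c_2) S(c_1), which is expanded here on the dual bases of A and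
    A^*. *)
Definition heis_of_endo (f : A -> A) : heisenberg A :=
  \sum_i tens (tlift (fun u v => f v * antipode u) (comul (r2v (delta_mx 0 i))))
              (dual_coord i).

Lemma heis_act_of_endo f : linear f -> heis_act (heis_of_endo f) =1 f.
Proof.
move=> f_lin c; pose g c := tlift (fun u v => f v * antipode u) (comul c).
have g_lin : linear g by multilinear.
pose T (x y z : A) := f z * (antipode y * x).
have T3 : trilinear T by multilinear.
transitivity (tlift (fun x y => tlift (T x) (comul y)) (comul c)).
  have op_g : heis_op (heis_of_endo f) =1 g.
    move=> v; rewrite (linear_r2v_sum v g_lin).
    rewrite /heis_op /heis_of_endo linear_sum.
    apply: eq_bigr => i _; rewrite /= tliftE ?dual_coordE //.
    by multilinear.
  rewrite heis_actE; apply: eq_tlift => x y; rewrite op_g tliftMl.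
  by apply: eq_tlift => u v; rewrite /T mulrA.
rewrite sweedlerA // -[RHS](tlift_counitl f f_lin); apply: eq_tlift => x z.
rewrite (tlift_antipodel_flip (fun u => f z * u)); last by multilinear.
by rewrite mulr1.
Qed.

Definition heis_conj s : heisenberg A :=
  heis_of_endo (fun c => antipode (heis_act s (antipode c))).

Lemma heis_act_conj s c :
  heis_act (heis_conj s) c = antipode (heis_act s (antipode c)).
Proof.
rewrite heis_act_of_endo //; apply: (linear_compose (linearP antipode)).
by apply: (linear_compose (heis_act_linear s)); multilinear.
Qed.

Fact heis_conj_linear : linear heis_conj.
Proof.
move=> d s t; apply: heis_act_inj => c; rewrite heis_act_linearl !heis_act_conj.
by rewrite heis_act_linearl linearP.
Qed.

Fact heis_conj_monoid : monoid_morphism heis_conj.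
Proof.
split=> [|s t]; apply: heis_act_inj => c.
  by rewrite heis_act_conj !heis_act1 antipodeK.
by rewrite heis_actM !heis_act_conj heis_actM antipodeK.
Qed.

HB.instance Definition _ := GRing.isLinear.Build k (heisenberg A) (heisenberg A)
  *:%R heis_conj heis_conj_linear.
HB.instance Definition _ := GRing.isMonoidMorphism.Build (heisenberg A)
  (heisenberg A) heis_conj heis_conj_monoid.

Lemma heis_conjK : involutive heis_conj.
Proof.
by move=> s; apply: heis_act_inj => c; rewrite !heis_act_conj !antipodeK.
Qed.

Lemma dual_antipodeE p a : dual_antipode p a = p (antipode a).
Proof. by rewrite comp_lfunE. Qed.

Lemma heis_conj_dual p : heis_conj (heis_dual p) = heis_dual (dual_antipode p).
Proof.
apply: heis_act_inj => c; rewrite heis_act_conj !heis_act_dual /dual_act.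
rewrite linear_tlift; last by multilinear.
rewrite sweedler_antipode_cocomm; last by multilinear.
by apply: eq_tlift => u v; rewrite linearZ /= antipodeK dual_antipodeE.
Qed.

Lemma heis_act_conj_left a c :
  heis_act (heis_conj (heis_left a)) c = c * antipode a.
Proof. by rewrite heis_act_conj heis_act_left antipodeM antipodeK. Qed.

(** In End(A) this is associativity of A: the left multiplication by a commutes
    with the right multiplication by S(b). *)
Lemma heis_left_conjC a b :
  heis_left a * heis_conj (heis_left b) = heis_conj (heis_left b) * heis_left a.
Proof.
apply: heis_act_inj => c.
by rewrite !heis_actM !heis_act_conj_left !heis_act_left mulrA.
Qed.

End HeisenbergEndomorphisms.

(** * The right adjoint action along an algebra morphism *)
Section RightAdjointAction.
Variables (k : fieldType) (A : hopfAlgType k) (K : algType k).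
Variable l : {lrmorphism A -> K}.
Implicit Types (g h : A) (x y : K).

Definition right_adjoint x h : K :=
  tlift (fun h1 h2 => l (antipode h1) * x * l h2) (comul h).

Fact right_adjoint_bilinear : bilinear_for *:%R *:%R right_adjoint.
Proof. by multilinear. Qed.

Fact right_adjoint1 x : right_adjoint x 1 = x.
Proof.
rewrite /right_adjoint sweedler1; last by multilinear.
by rewrite antipode1 rmorph1 mul1r mulr1.
Qed.

Fact right_adjointA x g h :
  right_adjoint x (g * h) = right_adjoint (right_adjoint x g) h.
Proof.
rewrite {1}/right_adjoint sweedlerM; last by multilinear.
rewrite exchange_tlift; apply: eq_tlift => h1 h2.
rewrite tliftMr tliftMl; apply: eq_tlift => g1 g2.
by rewrite antipodeM !rmorphM !mulrA.
Qed.

Fact right_adjoint_mul x y h :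
  right_adjoint (x * y) h =
  tlift (fun h1 h2 => right_adjoint x h1 * right_adjoint y h2) (comul h).
Proof.
(* The sum of l(S(h_1)) x l(h_2) l(S(h_3)) y l(h_4), whose middle contracts. *)
pose T u v w := l (antipode u) * x * l v * right_adjoint y w.
have T3 : trilinear T by multilinear.
transitivity (tlift (fun u w => tlift (T u) (comul w)) (comul h)); last first.
  by rewrite sweedlerA //; apply: eq_tlift => v w; rewrite tliftMl.
apply: eq_tlift => u w.
pose Q v z1 z2 := l (antipode u) * x * l (v * antipode z1) * y * l z2.
have Q3 : trilinear Q by multilinear.
transitivity (tlift (fun v z => tlift (Q v) (comul z)) (comul w)); last first.
  apply: eq_tlift => v z; rewrite /T tliftMr; apply: eq_tlift => z1 z2.
  by rewrite /Q rmorphM !mulrA.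
rewrite sweedlerA //.
rewrite -[LHS](tlift_counitl (fun z => l (antipode u) * (x * y) * l z));
  last by multilinear.
apply: eq_tlift => v z.
rewrite (tlift_antipoder (fun v => l (antipode u) * x * l v * y * l z));
  last by multilinear.
by rewrite rmorph1 mulr1 !mulrA.
Qed.

Fact right_adjoint_one h : right_adjoint 1 h = (counit h : k)%:A.
Proof.
rewrite -(rmorph1 l) -(tlift_antipodel l (linearP l)).
by apply: eq_tlift => h1 h2; rewrite rmorph1 mulr1 rmorphM.
Qed.

Lemma right_adjoint_central x h :
  (forall a, l a * x = x * l a) -> right_adjoint x h = (counit h : k) *: x.
Proof.
move=> xC; rewrite -[x in RHS]mul1r scalerAl -right_adjoint_one.
rewrite /right_adjoint tliftMl.
by apply: eq_tlift => h1 h2; rewrite mulr1 -!mulrA xC.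
Qed.

End RightAdjointAction.

(** * The bimodule algebra structure of the Heisenberg double *)
Section HeisenbergBimodule.
Variables (k : fieldType) (A : cocommHopfAlgType k).
Implicit Types (a g h : A) (p : dual A) (s t : heisenberg A).

Definition heis_ract s h : heisenberg A := right_adjoint (@heis_left k A) s h.

(** The right adjoint action transported by [heis_conj], with S to make it a
    left action, so that its module algebra axioms follow from those of
    [right_adjoint]. *)
Definition heis_lact h s : heisenberg A :=
  heis_conj (heis_ract (heis_conj s) (antipode h)).

Fact heis_lact_bilinear : bilinear_for *:%R *:%R heis_lact.
Proof.
have [Rl Rr] := right_adjoint_bilinear (@heis_left k A).
split=> [s c g h|h c s t]; rewrite /heis_lact /heis_ract.
  by rewrite linearP Rr linearP.
by rewrite linearP Rl linearP.
Qed.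

Fact heis_lact1 s : heis_lact 1 s = s.
Proof.
by rewrite /heis_lact antipode1 /heis_ract right_adjoint1 heis_conjK.
Qed.

Fact heis_lactA g h s : heis_lact (g * h) s = heis_lact g (heis_lact h s).
Proof.
by rewrite /heis_lact heis_conjK antipodeM /heis_ract right_adjointA.
Qed.

Fact heis_lact_mul h s t :
  heis_lact h (s * t) =
  tlift (fun h1 h2 => heis_lact h1 s * heis_lact h2 t) (comul h).
Proof.
rewrite /heis_lact rmorphM /heis_ract right_adjoint_mul linear_tlift;
  last by multilinear.
rewrite sweedler_antipode_cocomm; last by multilinear.
by apply: eq_tlift => h1 h2; rewrite rmorphM.
Qed.

Fact heis_lact_one h : heis_lact h 1 = (counit h : k)%:A.
Proof.
rewrite /heis_lact rmorph1 /heis_ract right_adjoint_one counit_antipode.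
by rewrite linearZ rmorph1.
Qed.

(** The left action is an adjoint action as well, for the copy of A acting by
    right multiplications. *)
Lemma heis_lactE h s : heis_lact h s =
  tlift (fun h1 h2 => heis_conj (heis_left h1) * s
    * heis_conj (heis_left (antipode h2))) (comul h).
Proof.
rewrite /heis_lact /heis_ract /right_adjoint linear_tlift; last by multilinear.
rewrite sweedler_antipode_cocomm; last by multilinear.
by apply: eq_tlift => h1 h2; rewrite !rmorphM /= heis_conjK antipodeK.
Qed.

Fact heis_lractA g s h :
  heis_ract (heis_lact g s) h = heis_lact g (heis_ract s h).
Proof.
rewrite !heis_lactE /heis_ract /right_adjoint.
under eq_tlift do rewrite tliftMr tliftMl.
under [RHS]eq_tlift do rewrite tliftMr tliftMl.
rewrite exchange_tlift; apply: eq_tlift => g1 g2; apply: eq_tlift => h1 h2.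
by rewrite !mulrA heis_left_conjC -!mulrA heis_left_conjC.
Qed.

Definition heis_bimod : bimod_algebra A (heisenberg A) :=
  let l := @heis_left k A in
  BimodAlgebra heis_lact_bilinear (right_adjoint_bilinear l)
    heis_lact1 heis_lactA (right_adjoint1 l) (right_adjointA l) heis_lractA
    heis_lact_mul (right_adjoint_mul l) heis_lact_one (right_adjoint_one l).

(** S(h_1) (1 # p) h_2 = S(h_1) h_2 (1 # p ↼ h_3) by the commutation rule. *)
Lemma heis_ract_dual p h :
  heis_ract (heis_dual p) h = heis_dual (dual_ract p h).
Proof.
pose T u v w := heis_left (antipode u * v) * heis_dual (dual_ract p w).
have T3 : trilinear T by multilinear.
transitivity (tlift (fun u w => tlift (T u) (comul w)) (comul h)).
  apply: eq_tlift => u w; rewrite -mulrA heis_dual_left tliftMr.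
  by apply: eq_tlift => v z; rewrite /T rmorphM mulrA.
rewrite sweedlerA // -[RHS](tlift_counitl (fun h => heis_dual (dual_ract p h)));
  last by multilinear.
apply: eq_tlift => v z.
rewrite (tlift_antipodel (fun u => heis_left u * heis_dual (dual_ract p z)));
  last by multilinear.
by rewrite rmorph1 mul1r.
Qed.

Lemma heis_lact_dual h p :
  heis_lact h (heis_dual p) = heis_dual (dual_lact h p).
Proof.
rewrite /heis_lact heis_conj_dual heis_ract_dual heis_conj_dual.
congr heis_dual; apply/dualP => c.
rewrite dual_antipodeE dual_ractE dual_antipodeE dual_lactE.
by rewrite -antipodeM antipodeK.
Qed.

Lemma heis_lact_left h a :
  heis_lact h (heis_left a) = (counit h : k) *: heis_left a.
Proof.
rewrite /heis_lact /heis_ract right_adjoint_central => [|b];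
  last exact: heis_left_conjC.
by rewrite linearZ /= heis_conjK counit_antipode.
Qed.

(** Reversing S(h_1) x h_2 gives S(h_2) omega(x) S(S(h_1)), the same expression
    for omega(x), by cocommutativity and since S is an involution. *)
Lemma heis_transpose_ract s h :
  heis_transpose (heis_ract s h) = heis_ract (heis_transpose s) h.
Proof.
rewrite /heis_ract /right_adjoint linear_tlift; last by multilinear.
rewrite sweedlerC; last by multilinear.
apply: eq_tlift => h1 h2.
by rewrite !heis_transposeM !heis_transpose_left antipodeK mulrA.
Qed.

(** As both sides respect products up to reversal, it is enough to compare them
    on generators: h acts through the counit on the copy of A, which
    [heis_transpose] preserves, and [heis_transpose] fixes the copy of A^*. *)
Lemma heis_transpose_lact h s :
  heis_transpose (heis_lact h s) = heis_lact h (heis_transpose s).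
Proof.
have lact_lin := heis_lact_bilinear.2 h.
move: s; apply: linear_heis_ext => [||a p].
- by multilinear.
- by multilinear.
have left_lin := heis_lact_bilinear.1 (heis_left a).
have dual_lin := heis_lact_bilinear.1 (heis_dual p).
(* The two sides list h_1 and h_2 in opposite orders. *)
rewrite heis_tens heis_lact_mul heis_transposeM heis_lact_mul.
rewrite linear_tlift; last by multilinear.
rewrite sweedlerC; last by multilinear.
apply: eq_tlift => h1 h2.
rewrite heis_transposeM !heis_transpose_left !heis_transpose_dual.
rewrite !heis_lact_left linearZ /= heis_transpose_left.
by rewrite heis_lact_dual heis_transpose_dual.
Qed.

End HeisenbergBimodule.

Theorem proposition6p3 (k : fieldType) (A : cocommHopfAlgType k) :
  inhabited (vertex_group A (heisenberg A)).
Proof.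
constructor.
pose tau : {linear heisenberg A -> heisenberg A} :=
  @heis_conj k A \o @heis_transpose k A.
apply: (@VertexGroup k A (heisenberg A) (heis_bimod A) (@heis_dual k A) _ tau).
- split=> [h p|p h] /=.
    by rewrite heis_lact_dual.
  by rewrite -heis_ract_dual.
- exact: bij_comp (inv_bij (@heis_conjK k A)) (inv_bij (@heis_transposeK k A)).
- rewrite /= -(rmorph1 (@heis_left k A)) heis_transpose_left antipode1.
  by rewrite !rmorph1.
- by move=> s t; rewrite /= heis_transposeM rmorphM.
- by move=> p; rewrite /= heis_transpose_dual heis_conj_dual.
- by move=> h s; rewrite /= heis_transpose_lact; apply: heis_conjK.
- move=> s h; rewrite /= -[right_adjoint _ _ _]/(heis_ract s h).
  by rewrite heis_transpose_ract /heis_lact heis_conjK antipodeK.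
Qed.
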